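(* Let $A$ be a C$^*$-algebra and let $B$ be a Čebyšëv C$^*$-subalgebra of $A$ (respectively, a Čebyšëv JB$^*$-subtriple of $A$). Suppose $B$ has rank greater than or equal to three. Then $A=B$.
   Context: Every C$^*$-algebra is a JB$^*$-triple with the triple product $\{a,b,c\}=\frac12(ab^*c+cb^*a)$. A JB$^*$-subtriple of $A$ is a norm-closed linear subspace closed under this triple product. A subspace $V$ of a Banach space $X$ is a Čebyšëv subspace if for each $x\in X$ there is a unique point $\pi_V(x)\in V$ with $\operatorname{dist}(x,V)=\|x-\pi_V(x)\|$. A Čebyšëv C$^*$-subalgebra (respectively, Čebyšëv JB$^*$-subtriple) of $A$ is a C$^*$-subalgebra (respectively, JB$^*$-subtriple) of $A$ which is a Čebyšëv subspace of $A$. With $L(a,b)z=\{a,b,z\}$, elements $a,b$ are orthogonal, $a\perp b$, if $L(a,b)=0$. A subset $S\subseteq B$ is orthogonal if $0\notin S$ and $x\perp y$ for all $x\neq y$ in $S$. The rank of $B$ is the minimal cardinal $r$ with $\operatorname{card}(S)\le r$ for every orthogonal subset $S\subseteq B$. *)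

(* Defs.v *)
From HB Require Import structures.
From mathcomp Require Import all_boot all_order all_algebra.
From mathcomp Require Import all_classical all_reals all_analysis.
From mathcomp Require Import complex.
Import Order.TTheory GRing.Theory Num.Theory.
Import numFieldNormedType.Exports.
Set Implicit Arguments.
Unset Strict Implicit.
Unset Printing Implicit Defensive.

Local Open Scope classical_set_scope.
Local Open Scope ring_scope.
Local Open Scope card_scope.
Local Open Scope complex_scope.

(* Neither a unit nor nontriviality is assumed, so the product cannot come from
   the library's (unital) ring structures. *)
HB.mixin Record CompleteNormedModule_isCStarAlgebra (R : realType) A
    of CompleteNormedModule R[i] A := {
  cmul : A -> A -> A;
  star : A -> A;
  cmulA : associative cmul;
  cmulDl : left_distributive cmul +%R;
  cmulDr : right_distributive cmul +%R;
  cmulZl : forall (c : R[i]) a b, cmul (c *: a) b = c *: cmul a b;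
  cmulZr : forall (c : R[i]) a b, cmul a (c *: b) = c *: cmul a b;
  normr_cmul_le : forall a b, `|cmul a b| <= `|a| * `|b|;
  starK : involutive star;
  starD : {morph star : a b / a + b};
  starZ : forall (c : R[i]) a, star (c *: a) = Num.conj c *: star a;
  starM : forall a b, star (cmul a b) = cmul (star b) (star a);
  normr_star_cmul : forall a, `|cmul (star a) a| = `|a| ^+ 2
}.

#[short(type="cstarAlgType")]
HB.structure Definition CStarAlgebra (R : realType) :=
  {A of CompleteNormedModule_isCStarAlgebra R A & CompleteNormedModule R[i] A}.

Section Chebyshev.
Context {R : realType} {X : normedModType R[i]}.
Implicit Types (x v : X) (V : set X).

(* The library norm of a complex normed module takes its values in R[i];
   [normR] is the same norm viewed in R, where infima exist. *)
Definition normR x : R := complex.Re `|x|.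

Lemma normRE x : (normR x)%:C = `|x|.
Proof.
rewrite /normR; have := normr_ge0 x.
by case: `|x| => a b; rewrite lecE /= => /andP[/eqP ->].
Qed.

Definition dist_to x V : R := inf [set normR (x - v) | v in V].

Definition chebyshev_subspace V :=
  submod_closed (mem V) /\
  forall x, exists! v, V v /\ dist_to x V = normR (x - v).

End Chebyshev.

Section Substructures.
Context {R : realType} {A : cstarAlgType R}.
Implicit Types (a b c x y z : A) (B S : set A).

Definition triple a b c : A :=
  (2^-1 : R[i]) *: (cmul (cmul a (star b)) c + cmul (cmul c (star b)) a).

Definition cstar_subalgebra B :=
  [/\ submod_closed (mem B),
      forall a b, B a -> B b -> B (cmul a b),
      forall a, B a -> B (star a)
    & closed B].

Definition jbstar_subtriple B :=
  [/\ submod_closed (mem B),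
      forall a b c, B a -> B b -> B c -> B (triple a b c)
    & closed B].

Definition chebyshev_cstar_subalgebra B :=
  cstar_subalgebra B /\ chebyshev_subspace B.

Definition chebyshev_jbstar_subtriple B :=
  jbstar_subtriple B /\ chebyshev_subspace B.

(* Orthogonality and rank are those of [B] as a triple in its own right:
   L(a, b) is an operator on [B], not on the ambient algebra. *)
Definition orth B a b := forall z, B z -> triple a b z = 0.

Definition orthogonal_subset B S :=
  [/\ S `<=` B, ~ S 0 & forall x y, S x -> S y -> x <> y -> orth B x y].

(* Cardinals are represented by sets compared through [#<=], so the rank,
   which may be infinite, is determined up to equipotence. *)
Definition bounds_orthogonal B (T : Type) (r : set T) :=
  forall S, orthogonal_subset B S -> S #<= r.

Definition is_rank B (T : Type) (r : set T) :=
  bounds_orthogonal B r /\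
  forall (T' : Type) (r' : set T'), bounds_orthogonal B r' -> r #<= r'.

End Substructures.

Section RankExists.

Lemma card_le_rel (T U : Type) (A : set T) (B : set U) (G : T -> U -> Prop) :
  (forall x, A x -> exists y, B y /\ G x y) ->
  (forall x x' y, G x y -> G x' y -> x = x') -> A #<= B.
Proof.
move=> tot inj.
have [->|/set0P[x0 Ax0]] := eqVneq A set0; first exact: card_ge0.
have [y0 _] := tot _ Ax0.
have /boolp.choice[f fP] x : exists y, A x -> B y /\ G x y.
  have [Ax|nAx] := pselect (A x); last by exists y0.
  by have [y yP] := tot x Ax; exists y.
have [|g] := (@injfunPex _ _ A B).2.
  exists f; first by move=> x /fP[].
  move=> x x' /set_mem Ax /set_mem Ax' e.
  by apply: (inj _ _ (f x)); [case: (fP x Ax)|rewrite e; case: (fP x' Ax')].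
exact: inj_card_le g.
Qed.

Lemma card_min (I : Type) (T : I -> Type) (X : forall i, set (T i)) :
  I -> exists i, forall j, X i #<= X j.
Proof.
move=> i0.
pose P (F : set (forall i, T i)) :=
  (forall f, F f -> forall i, X i (f i)) /\
  (forall f g i, F f -> F g -> f i = g i -> f = g).
have [F [[FX Finj] Fmax]] : exists F, P F /\ forall G, F `<` G -> ~ P G.
  apply: Zorn_bigcup => C CP totC; split.
    by move=> f [F CF Ff]; exact: (CP _ CF).1.
  move=> f g i [F CF Ff] [G CG Gg].
  have [FG|GF] := totC _ _ CF CG.
    by apply: (CP _ CG).2 => //; exact: FG.
  by apply: (CP _ CF).2 => //; exact: GF.
have [i iP] : exists i, forall x, X i x -> exists f, F f /\ f i = x.
  apply: contrapT => no.
  have ex i : exists x, X i x /\ ~ exists f, F f /\ f i = x.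
    apply: contrapT => no'; apply: no; exists i => x Xx.
    by apply: contrapT => no''; apply: no'; exists x.
  pose g i := projT1 (cid (ex i)).
  have gX i : X i (g i) by rewrite /g; case: cid => ? [].
  have gF i f : F f -> f i <> g i.
    by rewrite /g; case: cid => x [_ nx] /= Ff e; apply: nx; exists f.
  apply: (Fmax (F `|` [set g])).
    split; first by move=> f Ff; left.
    by move=> /(_ g (or_intror erefl)) /(gF i0); exact.
  split; first by move=> f [Ff|->] //; exact: FX.
  move=> f h i [Ff|->] [Fh|->] //; first exact: Finj.
    by move=> e; case: (gF i f Ff e).
  by move=> e; case: (gF i h Fh (esym e)).
exists i => j.
apply: (@card_le_rel _ _ _ _ (fun x y => exists f, [/\ F f, f i = x & f j = y])).
  move=> x /iP[f [Ff fx]]; exists (f j); split; first exact: FX.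
  by exists f.
move=> x x' y [f [Ff <- fy]] [g [Fg <- gy]].
by rewrite (Finj f g j Ff Fg) // fy gy.
Qed.

Lemma card_le_total (T U : Type) (A : set T) (B : set U) :
  A #<= B \/ B #<= A.
Proof.
pose V b := if b then T else U.
pose X : forall b, set (V b) := fun b => if b return set (V b) then A else B.
by have [[] h] := card_min X true; [left; exact: h false|right; exact: h true].
Qed.

Lemma is_rank_exists (R : realType) (A : cstarAlgType R) (B : set A) :
  exists r : set A, is_rank B r.
Proof.
have bB : bounds_orthogonal B B by move=> S [SB _ _]; exact: subset_card_le.
have [[r br] rmin] := card_min (fun r : {r : set A | bounds_orthogonal B r} =>
  sval r) (exist _ B bB).
exists r; split=> // T' r' br'.
have [Br'|r'B] := card_le_total B r'.
  exact: card_le_trans (rmin (exist _ B bB)) Br'.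
have /pcard_leP[f] := r'B.
have fr' : r' #= [set f x | x in r'].
  by rewrite card_eq_sym; apply: inj_card_eq; exact: 'inj_f.
have bf : bounds_orthogonal B [set f x | x in r'].
  move=> S /br' Sr'; apply: card_le_trans Sr' _.
  by move/card_eqPle: fr' => [].
apply: card_le_trans (rmin (exist _ _ bf)) _.
exact: card_image_le.
Qed.

End RankExists.

(* Main.v *)
Require Import Defs.
From mathcomp Require Import all_boot all_order all_algebra.
From mathcomp Require Import all_classical all_reals all_analysis.
From mathcomp Require Import complex ring lra.
Import Order.TTheory GRing.Theory Num.Theory.
Import numFieldNormedType.Exports.

Local Open Scope classical_set_scope.
Local Open Scope card_scope.

(* Let p, q be self-adjoint with D z = p z + z q preserving B. Then D is
   hermitian, so 1 + i s D does not decrease norms for s > 0, and for small s it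
   is invertible on B. If 0 is the nearest point of B to w and D w lies in B,
   then (1 + i s D)(w + c) = w has a solution c in B; since |w + c| <= |w|,
   uniqueness of the nearest point gives c = 0, hence D w = 0.

   For a nonzero a in B apply this to 2 L(a, a) and 2 L({a, a, a}, a), i.e. to
   (p, q) and (p^2, q^2) with p = a a^*, q = a^* a: if both operators send y into
   B, then w = y - pi(y) is killed by both, hence orthogonal to a. But then
   |w - s a| <= |w| for s |a| <= |w|, so uniqueness forces w = 0, i.e. y in B.

   Rank at least three provides nonzero, pairwise orthogonal a1, a2, a3 in B.
   The criterion applies successively to p1 x q2 and p2 x q1 (with a3), to p1 x
   and x q1 (with a2), and to x (with a1). *)

Section RealNorm.
Local Open Scope ring_scope.
Local Open Scope complex_scope.
Context {R : realType} {X : normedModType R[i]}.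
Implicit Types (x y z : X) (s t : R).

Lemma normR_ge0 x : 0 <= normR x.
Proof. by rewrite -lecR normRE normr_ge0. Qed.

Lemma normR_eq0 x : normR x = 0 -> x = 0.
Proof. by move=> h; apply/normr0_eq0; rewrite -normRE h. Qed.

Lemma normRN x : normR (- x) = normR x.
Proof. by rewrite /normR normrN. Qed.

Lemma normR_distC x y : normR (x - y) = normR (y - x).
Proof. by rewrite -normRN opprB. Qed.

Lemma normR_triangle x y : normR (x + y) <= normR x + normR y.
Proof. by rewrite -lecR rmorphD /= !normRE ler_normD. Qed.

Lemma normRZ t x : normR (t%:C *: x) = `|t| * normR x.
Proof.
apply: complexI.
by rewrite rmorphM /= !normRE normrZ normc_def /= expr0n addr0 sqrtr_sqr.
Qed.

Lemma normRZi t x : normR ((t%:C * 'i) *: x) = `|t| * normR x.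
Proof.
rewrite -scalerA normRZ /normR normrZ normc_def /=.
by rewrite expr0n expr1n add0r sqrtr1 mul1r.
Qed.

End RealNorm.

(** * Fixed points of contractions of ratio 1/2 *)

Section FixedPoint.
Local Open Scope ring_scope.
Local Open Scope complex_scope.
Context {R : realType} {V : completeNormedModType R[i]}.

Lemma geometric_half_lt (k e : R) : 0 <= k -> 0 < e -> exists n, k / 2 ^+ n < e.
Proof.
move=> k0 e0; exists (Num.bound (k / e)).
rewrite ltr_pdivrMr ?exprn_gt0// [ltRHS]mulrC -ltr_pdivrMr//.
apply: lt_le_trans (archi_boundP _) _; first by rewrite divr_ge0// ltW.
by rewrite -natrX ler_nat ltnW// ltn_expl.
Qed.

(** Banach's argument: the iterates from [x0] are Cauchy by geometric decay, and their limit stays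
    in the closed set [U]. *)
Lemma contraction_half_fixed_point (U : set V) (f : V -> V) (x0 : V) :
  closed U -> U x0 -> (forall x, U x -> U (f x)) ->
  (forall x y, normR (f x - f y) <= normR (x - y) / 2) ->
  exists2 c, U c & f c = c.
Proof.
move=> clU Ux0 Uf fhalf.
pose s n := iter n f x0; pose K := normR (f x0 - x0).
have Us n : U (s n) by elim: n => //= n; exact: Uf.
have step n : normR (s n.+1 - s n) <= K / 2 ^+ n.
  elim: n => [|n ih]; first by rewrite expr0 divr1.
  apply: le_trans (fhalf _ _) _; rewrite exprSr invfM mulrA.
  by rewrite ler_pM2r.
(* The right-hand side is the geometric sum of the bounds [step] from [n] to [n + m - 1], in closed
   form. *)
have tail n m :
    normR (s n - s (n + m)%N) <= 2 * K / 2 ^+ n - 2 * K / 2 ^+ (n + m).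
  elim: m => [|m ih]; first by rewrite addn0 !subrr /normR normr0.
  have -> : s n - s (n + m.+1)%N =
      (s n - s (n + m)%N) - (s (n + m).+1 - s (n + m)%N).
    by rewrite addnS opprB addrA subrK.
  apply: le_trans (normR_triangle _ _) _; rewrite normRN.
  apply: le_trans (lerD ih (step _)) _.
  rewrite addnS exprS invfM; set w := _^-1; lra.
have K2 : 0 <= 2 * K by rewrite mulr_ge0 ?normR_ge0.
have /cauchy_cvgP cs : cauchy (s @ \oo).
  apply: cauchy_exP => e e0.
  (* A positive element of [R[i]] is real, so the estimate can be made in [R]. *)
  have [eE /(geometric_half_lt _ _ K2)[n nP]] :
      e = (complex.Re e)%:C /\ 0 < complex.Re e.
    by case: e e0 => a b; rewrite ltcE /= => /andP[/eqP ->].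
  exists (s n), n => // m /= /subnKC <-.
  rewrite -ball_normE /= -normRE.
  rewrite eE ltcR; apply: le_lt_trans nP.
  apply: le_trans (tail _ _) _.
  by rewrite lerBlDr lerDl mulr_ge0 ?invr_ge0 ?exprn_ge0.
set c := lim (s @ \oo) in cs *.
have Uc : U c by apply: closed_cvg cs => //; exact: nearW.
exists c => //; apply/eqP; rewrite -subr_eq0; apply/eqP/normR_eq0.
apply/eqP; rewrite eq_le normR_ge0 andbT; apply/ler_addgt0Pr => e e0.
rewrite add0r.
have e2 : 0 < (e / 2)%:C :> R[i] by rewrite ltcR divr_gt0.
have /cvgrPdist_lt/(_ _ e2)[N _ NP] := cs.
have := NP N (leqnn N); have := NP N.+1 (leqnSn N).
rewrite /= -!normRE !ltcR => h1 h2.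
have -> : f c - c = (f c - f (s N)) + (s N.+1 - c) by rewrite addrA subrK.
apply: le_trans (normR_triangle _ _) _.
apply: le_trans (lerD (fhalf _ _) (lexx _)) _.
rewrite (normR_distC (s N.+1)); have := normR_ge0 (c - s N); lra.
Qed.

End FixedPoint.

(** * Consequences of the C*-identity *)

Section CStarIdentities.
Local Open Scope ring_scope.
Local Open Scope complex_scope.
Context {R : realType} {A : cstarAlgType R}.
Implicit Types (a b p q u v z : A) (s t : R).

Lemma cmul0 a : cmul a 0 = 0.
Proof. by rewrite -(scale0r 0) cmulZr !scale0r. Qed.

Lemma mul0c a : cmul 0 a = 0.
Proof. by rewrite -(scale0r 0) cmulZl !scale0r. Qed.

Lemma cmulNr a b : cmul a (- b) = - cmul a b.
Proof. by rewrite -scaleN1r cmulZr scaleN1r. Qed.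

Lemma mulNc a b : cmul (- a) b = - cmul a b.
Proof. by rewrite -scaleN1r cmulZl scaleN1r. Qed.

Lemma star0 : star (0 : A) = 0.
Proof. by apply: (addrI (star 0)); rewrite -starD !addr0. Qed.

Lemma normR_cmul a b : normR (cmul a b) <= normR a * normR b.
Proof. by rewrite -lecR rmorphM /= !normRE normr_cmul_le. Qed.

Lemma normR_star_cmul a : normR (cmul (star a) a) = normR a ^+ 2.
Proof. by apply: complexI; rewrite rmorphXn /= !normRE normr_star_cmul. Qed.

(** Cancel [|b|] in [|b|^2 = |b^* b| <= |b^*| |b|], then exchange [b] and [b^*]. *)
Lemma normR_star a : normR (star a) = normR a.
Proof.
suff le b : normR b <= normR (star b).
  by apply/eqP; rewrite eq_le le -{2}(starK a) le.
have [->|b0] := eqVneq (normR b) 0; first exact: normR_ge0.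
have bp : 0 < normR b by rewrite lt_def b0 normR_ge0.
by rewrite -(ler_pM2r bp) -expr2 -normR_star_cmul normR_cmul.
Qed.

Lemma star_cmul_eq0 a : cmul (star a) a = 0 -> a = 0.
Proof.
move=> h; apply: normR_eq0; apply/eqP; rewrite -sqrf_eq0 -normR_star_cmul h.
by rewrite /normR normr0.
Qed.

Lemma cmul_star_eq0 a : cmul a (star a) = 0 -> a = 0.
Proof.
by rewrite -{1}(starK a) => /star_cmul_eq0 /(congr1 star); rewrite starK star0.
Qed.

Lemma star_orthC a b : cmul (star a) b = 0 -> cmul (star b) a = 0.
Proof. by move=> /(congr1 star); rewrite starM starK star0. Qed.

Lemma cmul_star_orthC a b : cmul a (star b) = 0 -> cmul b (star a) = 0.
Proof. by move=> /(congr1 star); rewrite starM starK star0. Qed.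

(** * Norm estimates for hermitian operators *)

Lemma conjC_imag t : Num.conj (t%:C * 'i) = - (t%:C * 'i) :> R[i].
Proof.
rewrite [LHS]/=; apply/eqP; rewrite eq_complex /=.
by rewrite !(mul0r, mulr0, mulr1, subr0, oppr0, addr0, add0r) !eqxx.
Qed.

Lemma imag_mul t : (t%:C * 'i) * (t%:C * 'i) = - (t ^+ 2)%:C :> R[i].
Proof. by rewrite mulrACA -[X in _ * X]expr2 sqr_i mulrN1 -rmorphM. Qed.

(** For self-adjoint [p] the terms of first order in [t] cancel in [w^* w], so the norm grows only
    to second order. *)
Lemma normR_add_imul_le p z t : star p = p ->
  normR (z + (t%:C * 'i) *: cmul p z) <= (1 + t ^+ 2 * normR p ^+ 2) * normR z.
Proof.
move=> ps; set w := z + _; set k := t ^+ 2 * normR p ^+ 2.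
have k0 : 0 <= k by rewrite mulr_ge0 ?sqr_ge0.
have wE : cmul (star w) w = cmul (star z) z +
    (t ^+ 2)%:C *: cmul (star (cmul p z)) (cmul p z).
  rewrite /w starD starZ !(cmulDl, cmulDr, cmulZl, cmulZr) starM ps !cmulA.
  rewrite conjC_imag scalerA mulNr imag_mul opprK scaleNr.
  by rewrite addrA addrK.
have : normR w ^+ 2 <= (1 + k) * normR z ^+ 2.
  rewrite -normR_star_cmul wE; apply: le_trans (normR_triangle _ _) _.
  rewrite normRZ !normR_star_cmul (ger0_norm (sqr_ge0 t)) mulrDl mul1r lerD2l.
  rewrite /k -mulrA ler_wpM2l ?sqr_ge0// -exprMn.
  by rewrite lerXn2r ?nnegrE ?mulr_ge0 ?normR_ge0 ?normR_cmul.
(* Square roots are avoided through [1 + k <= (1 + k)^2]. *)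
move=> h; rewrite -(@ler_pXn2r _ 2) ?nnegrE ?mulr_ge0 ?addr_ge0 ?normR_ge0//.
apply: le_trans h _; rewrite exprMn ler_wpM2r ?sqr_ge0//.
by rewrite expr2 ler_peMr ?lerDl ?addr_ge0.
Qed.


Definition lrsum p q z := cmul p z + cmul z q.

Lemma lrsumB p q u v : lrsum p q (u - v) = lrsum p q u - lrsum p q v.
Proof. by rewrite /lrsum cmulDl cmulDr mulNc cmulNr opprD addrACA. Qed.

Lemma normR_lrsum p q z : normR (lrsum p q z) <= (normR p + normR q) * normR z.
Proof.
apply: le_trans (normR_triangle _ _) _; rewrite mulrDl [normR q * _]mulrC.
by apply: lerD; exact: normR_cmul.
Qed.

(** The adjoint turns right multiplication into left multiplication and [t] into [- t]. *)
Lemma normR_add_imulr_le q z t : star q = q ->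
  normR (z + (t%:C * 'i) *: cmul z q) <= (1 + t ^+ 2 * normR q ^+ 2) * normR z.
Proof.
move=> qs; rewrite -normR_star starD starZ starM qs conjC_imag.
have := normR_add_imul_le q (star z) (- t) qs.
by rewrite rmorphN mulNr sqrrN normR_star.
Qed.

Lemma normR_add_ilrsum_le p q : star p = p -> star q = q ->
  exists2 C, 0 <= C & forall t z, t ^+ 2 <= 1 ->
    normR (z + (t%:C * 'i) *: lrsum p q z) <= (1 + C * t ^+ 2) * normR z.
Proof.
move=> ps qs; set P := normR p; set Q := normR q.
have [P0 Q0] : 0 <= P /\ 0 <= Q by split; exact: normR_ge0.
(* Expand [(1 + t^2 P^2) (1 + t^2 Q^2) + t^2 P Q] and use [t^4 <= t^2]. *)
exists (P ^+ 2 + Q ^+ 2 + P ^+ 2 * Q ^+ 2 + P * Q).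
  by rewrite !addr_ge0 ?mulr_ge0 ?sqr_ge0.
move=> t z t1; set c := t%:C * 'i; set u := z + c *: cmul p z.
(* Composing the left and right perturbations gives the wanted one plus [c^2 p z q], and
   [c^2 = - t^2]. *)
have -> : z + c *: lrsum p q z =
    (u + c *: cmul u q) + (t ^+ 2)%:C *: cmul (cmul p z) q.
  rewrite /u cmulDl cmulZl [c *: (_ + c *: _)]scalerDr scalerA imag_mul scaleNr.
  by rewrite !addrA subrK /lrsum scalerDr addrA.
apply: le_trans (normR_triangle _ _) _; rewrite normRZ (ger0_norm (sqr_ge0 t)).
have h1 := normR_add_imulr_le q u t qs; have h2 := normR_add_imul_le p z t ps.
have h3 : normR (cmul (cmul p z) q) <= P * normR z * Q.
  by apply: le_trans (normR_cmul _ _) _; rewrite ler_wpM2r ?normR_cmul.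
have s0 : 0 <= t ^+ 2 by exact: sqr_ge0.
rewrite -/P -/Q -/u in h1 h2 h3 *.
apply: le_trans (lerD h1 (ler_wpM2l s0 h3)) _.
have k0 : 0 <= 1 + t ^+ 2 * Q ^+ 2.
  by rewrite addr_ge0 ?ler01// mulr_ge0 ?sqr_ge0.
apply: le_trans (lerD (ler_wpM2l k0 h2) (lexx _)) _.
have n0 := normR_ge0 z; move: (normR z) n0 => n n0.
set s := t ^+ 2 in s0 t1 *.
have : 0 <= (1 - s) * (s * (P ^+ 2 * Q ^+ 2 * n)).
  by rewrite mulr_ge0 ?subr_ge0// mulr_ge0// mulr_ge0// mulr_ge0 ?sqr_ge0.
lra.
Qed.

(* [z] is a convex combination of [z + i s D z] and [z - i t D z]; let [t] tend
   to [0]. *)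
Lemma normR_le_add_ilrsum p q s z : star p = p -> star q = q -> 0 < s ->
  normR z <= normR (z + (s%:C * 'i) *: lrsum p q z).
Proof.
move=> ps qs s0; have [C C0 hC] := normR_add_ilrsum_le p q ps qs.
set G := z + _; set n := normR z; have n0 : 0 <= n by exact: normR_ge0.
have key t : 0 < t -> t <= 1 -> n <= normR G + t * (s * C * n).
  move=> t0 t1; set H := z + ((- t)%:C * 'i) *: lrsum p q z.
  have E : (s + t)%:C *: z = t%:C *: G + s%:C *: H.
    rewrite /G /H; move: (lrsum p q z) => d.
    rewrite !scalerDr !scalerA addrACA -!scalerDl.
    rewrite [X in _ + X *: _](_ : _ = 0); last by rewrite rmorphN /=; ring.
    by rewrite scale0r addr0 rmorphD addrC.
  have hH : normR H <= (1 + C * t ^+ 2) * n.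
    by rewrite -(sqrrN t); apply: hC; rewrite sqrrN expr_le1// ltW.
  have : (s + t) * n <= t * normR G + s * normR H.
    have st : 0 <= s + t by rewrite addr_ge0 ?ltW.
    rewrite -{1}(ger0_norm st) -normRZ E.
    apply: le_trans (normR_triangle _ _) _.
    by rewrite !normRZ (gtr0_norm t0) (gtr0_norm s0).
  move=> h; rewrite -(ler_pM2l t0).
  have := ler_wpM2l (ltW s0) hH; lra.
apply/ler_addgt0Pr => e e0.
set K := s * C * n in key.
have K0 : 0 <= K by rewrite mulr_ge0 // mulr_ge0 // ltW.
(* This ensures [t <= 1] and [t K <= e]; the [+ 1] covers [K = 0]. *)
pose t := Num.min 1 (e / (K + 1)).
have e1 : 0 < e / (K + 1) by rewrite divr_gt0 ?ltr_wpDl.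
have t0 : 0 < t by rewrite lt_min ltr01.
apply: le_trans (key t t0 _) _; first by rewrite ge_min lexx.
rewrite lerD2l; apply: (@le_trans _ _ (e / (K + 1) * K)).
  by rewrite ler_wpM2r// ge_min lexx orbT.
by rewrite mulrAC ler_pdivrMr ?ltr_wpDl// ler_wpM2l ?lerDl// ltW.
Qed.


(* The bound for the orthogonal pair [u^* u, v^* v] at scale [n] yields, by the
   C*-identity, the bound for [u, v] at scale [n.+1]. *)
Lemma normR_orth_add_le u v (k : R) :
  cmul (star u) v = 0 -> cmul u (star v) = 0 ->
  normR u <= k -> normR v <= k -> normR (u + v) <= k.
Proof.
move=> uv1 uv2 uk vk; apply/ler_addgt0Pr => e e0.
have k0 : 0 <= k by exact: le_trans (normR_ge0 u) uk.
have [n nP] := geometric_half_lt k e k0 e0.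
suff H : normR (u + v) <= k + k / 2 ^+ n.
  by apply: le_trans H _; rewrite lerD2l ltW.
clear nP e e0; elim: n k u v k0 uv1 uv2 uk vk => [|n ih] k u v k0 uv1 uv2 uk vk.
  rewrite expr0 divr1; apply: le_trans (normR_triangle _ _) _; exact: lerD.
have sq z : normR z <= k -> normR (cmul (star z) z) <= k ^+ 2.
  by move=> zk; rewrite normR_star_cmul lerXn2r ?nnegrE ?normR_ge0.
have E : cmul (star (u + v)) (u + v) = cmul (star u) u + cmul (star v) v.
  by rewrite starD !(cmulDl, cmulDr) uv1 (star_orthC _ _ uv1) addr0 add0r.
have F : cmul (cmul (star u) u) (cmul (star v) v) = 0.
  by rewrite -cmulA [cmul u _]cmulA uv2 mul0c cmul0.
have := ih (k ^+ 2) (cmul (star u) u) (cmul (star v) v) (sqr_ge0 k).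
rewrite !starM !starK => /(_ F F (sq _ uk) (sq _ vk)).
rewrite -E normR_star_cmul => h.
have w0 : 0 <= (2 ^+ n)^-1 :> R by rewrite invr_ge0 exprn_ge0.
rewrite -(@ler_pXn2r _ 2) ?nnegrE ?normR_ge0//; last first.
  by rewrite addr_ge0 ?mulr_ge0 ?invr_ge0 ?exprn_ge0.
apply: le_trans h _; rewrite [2 ^+ n.+1]exprS invfM; set w := (2 ^+ n)^-1.
(* The square of [k + k w / 2] exceeds [k^2 + k^2 w] by [(k w)^2 / 4]. *)
have : 0 <= (k * w) ^+ 2 by exact: sqr_ge0.
lra.
Qed.

Lemma addrr_eq0 z : z + z = 0 -> z = 0.
Proof.
move=> h; have : (2 : R[i]) *: z = 0 by rewrite scaler_nat mulr2n.
move=> /(congr1 ( *:%R 2^-1)).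
by rewrite scalerA mulVf ?pnatr_eq0// scale1r scaler0.
Qed.

(* From [p z = - z q] and [p p z = - z q q] one gets [z q q = 0], and the
   C*-identity removes the factors of [q] one by one. *)
Lemma orth_of_lrsum_eq0 a z :
  let p := cmul a (star a) in let q := cmul (star a) a in
  lrsum p q z = 0 -> lrsum (cmul p p) (cmul q q) z = 0 ->
  cmul z (star a) = 0 /\ cmul (star a) z = 0.
Proof.
move=> p q /eqP; rewrite /lrsum addr_eq0 => /eqP pz.
rewrite -cmulA pz cmulNr [cmul p _]cmulA pz mulNc opprK !cmulA.
move=> /addrr_eq0 zqq.
have qs : star q = q by rewrite /q starM starK.
have zq : cmul z q = 0.
  by apply: cmul_star_eq0; rewrite starM qs !cmulA zqq mul0c.
move: pz; rewrite zq oppr0 => pz; split.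
  apply: cmul_star_eq0; rewrite starM starK -!cmulA [cmul (star a) _]cmulA -/q.
  by rewrite cmulA zq mul0c.
apply: star_cmul_eq0; rewrite starM starK -!cmulA [cmul a _]cmulA -/p.
by rewrite pz cmul0.
Qed.

End CStarIdentities.

(** * Nearest points in a subspace *)

Section Chebyshev.
Local Open Scope ring_scope.
Local Open Scope complex_scope.
Context {R : realType} {A : cstarAlgType R} (B : set A).
Implicit Types (a b c p q w x y z : A).
Hypothesis B_submod : submod_closed (mem B).

Lemma submod0 : B 0.
Proof. by have [/set_mem] := B_submod. Qed.

Lemma submodZD (k : R[i]) x y : B x -> B y -> B (k *: x + y).
Proof.
by move=> /mem_set Bx /mem_set By; apply/set_mem; exact: B_submod.2.
Qed.

Lemma submodZ (k : R[i]) x : B x -> B (k *: x).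
Proof. by move=> Bx; rewrite -[_ *: _]addr0; exact: submodZD submod0. Qed.

Lemma submodD x y : B x -> B y -> B (x + y).
Proof. by move=> Bx By; rewrite -[x]scale1r; exact: submodZD. Qed.

Lemma submodN x : B x -> B (- x).
Proof. by rewrite -scaleN1r; exact: submodZ. Qed.

Lemma submodB x y : B x -> B y -> B (x - y).
Proof. by move=> Bx /submodN; exact: submodD. Qed.

(** Unique best approximation by 0, phrased without the infimum that defines the distance. *)
Definition zero_is_nearest w :=
  forall b, B b -> normR (w - b) <= normR w -> b = 0.

Lemma chebyshev_nearest x : chebyshev_subspace B ->
  exists2 b, B b & zero_is_nearest (x - b).
Proof.
move=> [_ /(_ x) [b [[Bb db] ub]]]; exists b => // c Bc le.
have Bbc : B (b + c) by exact: submodD.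
suff /(congr1 (fun z => z - b)) : b = b + c by rewrite subrr addrC addKr.
(* The point [b + c] is no farther from [x] than [b], so it attains the distance too. *)
apply: ub; split=> //; apply/eqP; rewrite eq_le; apply/andP; split.
  apply: ge_inf; last by exists (b + c).
  by exists 0 => _ [z _ <-]; exact: normR_ge0.
by rewrite db opprD addrA.
Qed.

Lemma nearest_lrsum_eq0 p q w : closed B -> star p = p -> star q = q ->
  (forall b, B b -> B (lrsum p q b)) -> zero_is_nearest w ->
  B (lrsum p q w) -> lrsum p q w = 0.
Proof.
move=> clB ps qs BD w0 BDw.
set M := normR p + normR q.
have M0 : 0 <= M by rewrite addr_ge0 ?normR_ge0.
have M1 : 0 < 2 * (M + 1) by rewrite mulr_gt0 ?ltr_wpDl.
(* Since [M] bounds the norm of [D], this gives [s M <= 1/2], the contraction ratio of [f] below. *)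
pose s := (2 * (M + 1))^-1; have s0 : 0 < s by rewrite invr_gt0.
(* A fixed point [c] solves [(1 + i s D)(w + c) = w]; [f] preserves [B] because [D w] lies in
   [B]. *)
pose f c := - ((s%:C * 'i) *: lrsum p q (w + c)).
have lrsumD u v : lrsum p q (u + v) = lrsum p q u + lrsum p q v.
  by rewrite /lrsum cmulDl cmulDr addrACA.
have [||c Bc fc] := contraction_half_fixed_point B f 0 clB submod0.
- move=> c Bc; apply/submodN/submodZ; rewrite lrsumD.
  by apply: submodD => //; exact: BD.
- move=> c c'; rewrite /f opprK addrC -scalerBr -lrsumB.
  rewrite [X in lrsum _ _ X](_ : _ = c' - c); last first.
    by rewrite opprD addrACA subrr add0r.
  rewrite normRZi gtr0_norm// (normR_distC c c').
  apply: le_trans (ler_wpM2l (ltW s0) (normR_lrsum _ _ _)) _; rewrite -/M.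
  rewrite mulrA mulrC ler_wpM2l ?normR_ge0// /s mulrC ler_pdivrMr//; lra.
(* The competitor to 0 is [- c], at distance [|w + c| <= |w|] from [w]. *)
have c0 : c = 0.
  apply: oppr_inj; rewrite oppr0; apply: w0; first exact: submodN.
  rewrite opprK.
  apply: le_trans (normR_le_add_ilrsum p q s (w + c) ps qs s0) _.
  by rewrite -[(_ * _) *: _]opprK -/(f c) fc addrK.
move: fc; rewrite /f c0 addr0 => /eqP; rewrite oppr_eq0 => /eqP h.
apply: normR_eq0; apply: (mulfI (lt0r_neq0 s0)).
by rewrite mulr0 -{1}(gtr0_norm s0) -normRZi h /normR normr0.
Qed.


Lemma nearest_orth_eq0 a w : B a -> a <> 0 -> zero_is_nearest w ->
  cmul w (star a) = 0 -> cmul (star a) w = 0 -> w = 0.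
Proof.
move=> Ba a0 w0 wa aw.
have na : normR a != 0 by apply/eqP => /normR_eq0.
have n0 : 0 <= normR w / normR a by rewrite divr_ge0 ?normR_ge0.
(* This scale gives [|s a| = |w|], so orthogonality yields [|w - s a| <= |w|] and hence
   [s a = 0]. *)
set s := normR w / normR a in n0.
have ns : normR (s%:C *: a) = normR w by rewrite normRZ ger0_norm// divfK.
apply: normR_eq0; rewrite -ns; suff -> : s%:C *: a = 0 by rewrite /normR normr0.
apply: w0; first exact: submodZ.
have sN : star (- (s%:C *: a)) = (- s)%:C *: star a.
  rewrite -scaleN1r scalerA mulN1r -rmorphN starZ.
  by congr (_ *: _); exact: conjc_real.
apply: normR_orth_add_le; rewrite ?normRN ?ns//.
  by rewrite cmulNr cmulZr (star_orthC _ _ aw) scaler0 oppr0.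
by rewrite sN cmulZr wa scaler0.
Qed.

(** * Closed subtriples and the membership criterion *)

Hypothesis B_triple : forall a b c, B a -> B b -> B c -> B (triple a b c).
Hypothesis B_closed : closed B.

Lemma triple2E a b c : cmul (cmul a (star b)) c + cmul (cmul c (star b)) a =
  (2 : R[i]) *: triple a b c.
Proof. by rewrite /triple scalerA mulfV ?pnatr_eq0// scale1r. Qed.

Lemma cube_in a : B a -> B (cmul (cmul a (star a)) a).
Proof.
move=> Ba.
have -> : cmul (cmul a (star a)) a = triple a a a; last exact: B_triple.
by rewrite /triple scalerDr -scalerDl -[2^-1]div1r -splitr scale1r.
Qed.

Lemma lrsum1_in a b :
  B a -> B b -> B (lrsum (cmul a (star a)) (cmul (star a) a) b).
Proof.
move=> Ba Bb; rewrite /lrsum [cmul b _]cmulA triple2E.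
by apply: submodZ; exact: B_triple.
Qed.

Lemma lrsum2_in a b (p := cmul a (star a)) (q := cmul (star a) a) :
  B a -> B b -> B (lrsum (cmul p p) (cmul q q) b).
Proof.
move=> Ba Bb.
(* Here [p a] is the cube of [a], with [(p a) a^* = p p] and [a^* (p a) = q q]. *)
have -> : lrsum (cmul p p) (cmul q q) b =
    cmul (cmul (cmul p a) (star a)) b + cmul (cmul b (star a)) (cmul p a).
  by rewrite /lrsum /p /q !cmulA.
by rewrite triple2E; apply/submodZ/B_triple => //; exact: cube_in.
Qed.

(** Although [L(a, b)] vanishes only on [B], evaluating it at [b] and at the cube of [b] gives the
    two equations of [orth_of_lrsum_eq0]. *)
Lemma orth_cmul_eq0 a b : B a -> B b -> orth B a b ->
  cmul a (star b) = 0 /\ cmul (star b) a = 0.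
Proof.
move=> Ba Bb ab.
have ab2 c : B c -> cmul (cmul a (star b)) c + cmul (cmul c (star b)) a = 0.
  by move=> /ab h; rewrite triple2E h scaler0.
apply: orth_of_lrsum_eq0.
  by rewrite /lrsum addrC [cmul a _]cmulA; exact: ab2.
have := ab2 _ (cube_in b Bb); rewrite addrC /lrsum !cmulA; exact.
Qed.

Hypothesis B_chebyshev : chebyshev_subspace B.

Lemma lrsum_in_mem a y (p := cmul a (star a)) (q := cmul (star a) a) :
  B a -> a <> 0 -> B (lrsum p q y) -> B (lrsum (cmul p p) (cmul q q) y) -> B y.
Proof.
move=> Ba a0 By1 By2.
have [b Bb yb] := chebyshev_nearest y B_chebyshev.
have [ps qs] : star p = p /\ star q = q by rewrite /p /q !starM starK.
have D1 : lrsum p q (y - b) = 0.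
  apply: nearest_lrsum_eq0 => //; first by move=> c; exact: lrsum1_in.
  by rewrite lrsumB; apply: submodB => //; exact: lrsum1_in.
have D2 : lrsum (cmul p p) (cmul q q) (y - b) = 0.
  apply: nearest_lrsum_eq0; rewrite ?(starM p p) ?(starM q q) ?ps ?qs//.
    by move=> c; exact: lrsum2_in.
  by rewrite lrsumB; apply: submodB => //; exact: lrsum2_in.
have [ya ay] := orth_of_lrsum_eq0 a (y - b) D1 D2.
by rewrite -(subrK b y) (nearest_orth_eq0 a (y - b))// add0r.
Qed.

Lemma three_orth_full a1 a2 a3 x : B a1 -> B a2 -> B a3 ->
  a1 <> 0 -> a2 <> 0 -> a3 <> 0 ->
  orth B a1 a2 -> orth B a2 a3 -> orth B a3 a1 -> B x.
Proof.
move=> B1 B2 B3 n1 n2 n3.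
move=> /(orth_cmul_eq0 _ _ B1 B2)[r12 l21] /(orth_cmul_eq0 _ _ B2 B3)[r23 l32].
move=> /(orth_cmul_eq0 _ _ B3 B1)[r31 l13].
have l12 := star_orthC _ _ l21; have l23 := star_orthC _ _ l32.
have l31 := star_orthC _ _ l13.
have r21 := cmul_star_orthC _ _ r12; have r32 := cmul_star_orthC _ _ r23.
have r13 := cmul_star_orthC _ _ r31.
pose p a := cmul a (star a); pose q a := cmul (star a) a.
have pp0 a b : cmul (star a) b = 0 -> cmul (p a) (p b) = 0.
  by move=> ab; rewrite /p -cmulA [cmul (star a) _]cmulA ab mul0c cmul0.
have qq0 a b : cmul a (star b) = 0 -> cmul (q a) (q b) = 0.
  by move=> ab; rewrite /q -cmulA [cmul a _]cmulA ab mul0c cmul0.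
have mem c y : B c -> c <> 0 -> B (lrsum (p c) (q c) y) ->
    B (lrsum (cmul (p c) (p c)) (cmul (q c) (q c)) y) -> B y.
  exact: lrsum_in_mem.
clearbody p q.
(* Both operators attached to [c] vanish on [p_a y q_b]: [p_c] kills it from the left and [q_c] from
   the right. *)
have corner a b c y : B c -> c <> 0 ->
    cmul (star c) a = 0 -> cmul b (star c) = 0 -> B (cmul (cmul (p a) y) (q b)).
  move=> Bc c0 ca bc.
  have pk : cmul (p c) (cmul (cmul (p a) y) (q b)) = 0.
    by rewrite !cmulA pp0// !mul0c.
  have kq : cmul (cmul (cmul (p a) y) (q b)) (q c) = 0.
    by rewrite -cmulA qq0// cmul0.
  apply: (mem c) => //; rewrite /lrsum.
    by rewrite pk kq addr0; exact: submod0.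
  rewrite -cmulA pk [cmul _ (cmul (q c) _)]cmulA kq cmul0 mul0c addr0.
  exact: submod0.
(* The left term of each [a2] operator vanishes on [p1 y]; what remains is a corner [p1 y' q2], with
   [y'] equal to [y] or [y q2]. *)
have left y : B (cmul (p a1) y).
  have pk : cmul (p a2) (cmul (p a1) y) = 0 by rewrite cmulA pp0// mul0c.
  apply: (mem a2) => //; rewrite /lrsum.
    by rewrite pk add0r; exact: (corner a1 a2 a3).
  rewrite -cmulA pk cmul0 add0r cmulA -[cmul (cmul _ y) _]cmulA.
  exact: (corner a1 a2 a3).
have right y : B (cmul y (q a1)).
  have kq : cmul (cmul y (q a1)) (q a2) = 0 by rewrite -cmulA qq0// cmul0.
  apply: (mem a2) => //; rewrite /lrsum.
    by rewrite kq addr0 cmulA; exact: (corner a2 a1 a3).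
  rewrite [cmul _ (cmul (q a2) _)]cmulA kq mul0c addr0 -cmulA.
  rewrite [cmul (p a2) (cmul y _)]cmulA cmulA.
  exact: (corner a2 a1 a3).
(* For the squared operator, [left] is used at [p1 x] and [right] at [x q1]. *)
apply: (mem a1) => //; apply: submodD => //.
  by rewrite -cmulA; exact: left.
by rewrite cmulA; exact: right.
Qed.

End Chebyshev.

(** * Orthogonal triples from the rank, and the conclusion *)

Lemma card_two_points {T : Type} (S : set T) (x y : T) :
  S `<=` [set x; y] -> S #<= `I_2.
Proof.
move=> Sxy; pose f n := if n == 0 then x else y.
apply: card_le_trans (card_image_le f _).
by apply: subset_card_le => z /Sxy[] ->; [exists 0|exists 1].
Qed.

(** If every orthogonal subset had at most two elements, minimality of the rank would give
    [I_3 #<= I_2]. *)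
Lemma rank_ge3_orth {R : realType} {A : cstarAlgType R} {B : set A}
    {T : Type} {r : set T} : is_rank B r -> `I_3 #<= r ->
  exists a1 a2 a3, [/\ [/\ B a1, B a2 & B a3],
    [/\ a1 <> 0%R, a2 <> 0%R & a3 <> 0%R]
    & [/\ orth B a1 a2, orth B a2 a3 & orth B a3 a1]].
Proof.
move=> [_ rmin] r3.
have [S [SB S0 So] S2] : exists2 S, orthogonal_subset B S & ~ (S #<= `I_2).
  apply: contrapT => no.
  have : bounds_orthogonal B `I_2.
    by move=> S oS; apply: contrapT => nS; apply: no; exists S.
  by move=> /rmin /(card_le_trans r3); rewrite card_le_II.
have third x y : exists2 z, S z & z <> x /\ z <> y.
  apply: contrapT => no; apply: S2; apply: (@card_two_points _ _ x y) => z Sz.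
  by apply: contrapT => /not_orP[zx zy]; apply: no; exists z.
(* Degenerate pairs provide the first two elements; each choice avoids the earlier ones. *)
have [a1 S1 _] := third 0%R 0%R.
have [a2 S2' [n21 _]] := third a1 a1.
have [a3 S3 [n31 n32]] := third a1 a2.
exists a1, a2, a3; split; first by split; exact: SB.
  by split=> a0; apply: S0; rewrite -a0.
by split; apply: So => // /esym.
Qed.

Theorem corollary13 (R : realType) (A : cstarAlgType R) (B : set A)
    (T : Type) (rkB : set T) (rkB_rank : is_rank B rkB)
    (rkB_ge3 : `I_3 #<= rkB) :
  (chebyshev_cstar_subalgebra B -> B = [set: A]) /\
  (chebyshev_jbstar_subtriple B -> B = [set: A]).
Proof.
have jb : chebyshev_jbstar_subtriple B -> B = [set: A].
  move=> [[Bs Bt Bc] cB]; apply/seteqP; split=> // x _.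
  have [a1 [a2 [a3 [[B1 B2 B3] [n1 n2 n3] [or12 or23 or31]]]]] :=
    rank_ge3_orth rkB_rank rkB_ge3.
  exact: (three_orth_full B Bs Bt Bc cB a1 a2 a3).
(* A C*-subalgebra is closed under the triple product, so its case follows from that of
   subtriples. *)
split=> // -[[Bs Bm Bst Bc] cB].
apply: jb; split=> //; split=> // a b c Ba Bb Bc'.
by apply: submodZ => //; apply: submodD => //; do 2 apply: (Bm) => //; exact: Bst.
Qed.
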